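(* Let $A\in\mathbb{R}^{3\times 3}$. If each of the three singleton supports $\{1\},\{2\},\{3\}$ produces a Pareto eigenvalue, then $|\Pi_{\{1,2,3\}}(A)|\le 1$.
   Context: Vector inequalities are componentwise ($u>0$ means all components are positive). For $A\in\mathbb{R}^{n\times n}$, a support is a nonempty subset $J\subseteq\{1,\dots,n\}$, with complement $J^{\mathrm c}$; $A_J$ is the principal submatrix indexed by $J$ and $A_{J^{\mathrm c},J}$ is the submatrix with rows in $J^{\mathrm c}$ and columns in $J$. The support $J$ produces $\lambda\in\mathbb{R}$ if there is $u\in\mathbb{R}^{|J|}$ with $A_Ju=\lambda u$, $u>0$, $A_{J^{\mathrm c},J}u\ge 0$ (the last condition is empty if $J=\{1,\dots,n\}$). Values produced by some support are exactly the Pareto eigenvalues of $A$. The set of values produced by $J$ is denoted $\Pi_J(A)$. *)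

(* Defs.v *)
From HB Require Import structures.
From mathcomp Require Import all_boot all_order all_algebra.
From mathcomp Require Import classical_sets functions cardinality reals.

Set Implicit Arguments.
Unset Strict Implicit.
Unset Printing Implicit Defensive.

Import Order.TTheory GRing.Theory Num.Theory.
Local Open Scope ring_scope.

(* A_{I,J}: rows in I and columns in J, both listed in increasing order. *)
Definition set_submx (R : Type) (n : nat) (I J : {set 'I_n})
    (A : 'M[R]_n) : 'M[R]_(#|I|, #|J|) :=
  mxsub (fun i : 'I_#|I| => enum_val i) (fun j : 'I_#|J| => enum_val j) A.

Definition produces (R : realType) (n : nat) (A : 'M[R]_n)
    (J : {set 'I_n}) (lambda : R) : Prop :=
  J != finset.set0 /\
  exists u : 'cV[R]_#|J|,
    [/\ set_submx J J A *m u = lambda *: u,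
        forall i, 0 < u i 0
      & forall i, 0 <= (set_submx (~: J) J A *m u) i 0].

Definition produced_values (R : realType) (n : nat) (J : {set 'I_n})
    (A : 'M[R]_n) : set R :=
  [set lambda | produces A J lambda]%classic.

(* Main.v *)
(** The singleton supports force the off-diagonal entries of [A] to be
    nonnegative.  For such a matrix, let [u] and [v] be positive eigenvectors for
    [lambda] and [mu], and compare [v] with [t u], where [t] is the largest ratio
    [v_i / u_i]: at a row attaining it, [A (t u - v)] involves only off-diagonal
    entries of [A], hence is nonnegative, which says that [mu <= lambda].  By
    symmetry the two eigenvalues agree. *)
Require Import Defs.
From HB Require Import structures.
From mathcomp Require Import all_boot all_order all_algebra.
From mathcomp Require Import classical_sets functions cardinality reals.

Set Implicit Arguments.
Unset Strict Implicit.
Unset Printing Implicit Defensive.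

Import Order.TTheory GRing.Theory Num.Theory.
Local Open Scope ring_scope.

Lemma pos_eigenvalue_le (R : realFieldType) (n : nat) (A : 'M[R]_n.+1)
    (u v : 'cV[R]_n.+1) (lambda mu : R) :
  (forall i j, i != j -> 0 <= A i j) ->
  (forall i, 0 < u i 0) -> (forall i, 0 < v i 0) ->
  A *m u = lambda *: u -> A *m v = mu *: v -> mu <= lambda.
Proof.
move=> A_ge0 u_gt0 v_gt0 Au Av.
case: (@arg_maxP _ _ _ (ord0 : 'I_n.+1) xpredT (fun i => v i 0 / u i 0)) => // i _ imax.
set t := v i 0 / u i 0 in imax.
have tu_i : t * u i 0 = v i 0 by rewrite /t divfK // gt_eqF.
have v_le j : v j 0 <= t * u j 0 by rewrite -ler_pdivrMr //; apply: imax.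
have : 0 <= (A *m (t *: u - v)) i 0.
  rewrite mxE; apply: sumr_ge0 => j _; rewrite !mxE.
  have [<-|neq_ij] := eqVneq i j; first by rewrite tu_i subrr mulr0.
  by rewrite mulr_ge0 ?A_ge0 ?subr_ge0.
(* Since [t * u i 0 = v i 0], this entry is [(lambda - mu) * v i 0]. *)
rewrite mulmxBr -scalemxAr Au Av !mxE mulrCA tu_i -mulrBl.
by rewrite pmulr_lge0 // subr_ge0.
Qed.

(** The only column in play is [j], so row [i] of the complementary condition is [A i j] times the
    sum of the entries of [u], a positive factor. *)
Lemma produces_set1_offdiag_ge0 (R : realType) (n : nat) (A : 'M[R]_n)
    (i j : 'I_n) (lambda : R) :
  produces A [set j]%SET lambda -> i != j -> 0 <= A i j.
Proof.
move=> [_ [u [_ u_gt0 Au_ge0]]] neq_ij.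
have iP : i \in (~: [set j])%SET by rewrite !inE.
have jP : j \in [set j]%SET by rewrite inE.
have := Au_ge0 (enum_rank_in iP i); rewrite mxE.
under eq_bigr => k _.
  rewrite mxE enum_rankK_in //.
  have /set1P -> := enum_valP k.
  over.
rewrite -mulr_sumr pmulr_lge0 // (bigD1 (enum_rank_in jP j)) //=.
by rewrite ltr_pwDl // sumr_ge0 // => k _; rewrite ltW.
Qed.

Lemma produces_setT_inj (R : realType) (n : nat) (A : 'M[R]_n)
    (lambda mu : R) :
  (forall i j, i != j -> 0 <= A i j) ->
  produces A [set: 'I_n]%SET lambda -> produces A [set: 'I_n]%SET mu ->
  lambda = mu.
Proof.
move=> A_ge0 [T0 [u [Au u_gt0 _]]] [_ [v [Av v_gt0 _]]].
have B_ge0 i j : i != j -> 0 <= set_submx [set: 'I_n]%SET [set: 'I_n]%SET A i j.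
  by move=> neq_ij; rewrite mxE A_ge0 // (inj_eq enum_val_inj).
(* Abstracting the reindexed matrix frees its size [#|setT|], which nonemptiness of the support
   makes a successor. *)
move: (set_submx _ _ A) T0 u v u_gt0 v_gt0 Au Av B_ge0; rewrite -card_gt0.
case: #|_| => // m B _ u v u_gt0 v_gt0 Au Av B_ge0.
by apply/le_anti; rewrite (pos_eigenvalue_le B_ge0 v_gt0 u_gt0 Av Au)
  (pos_eigenvalue_le B_ge0 u_gt0 v_gt0 Au Av).
Qed.

Theorem lemma3p5 (R : realType) (A : 'M[R]_3)
    (hA : forall i : 'I_3, exists lambda : R, produces A [set i]%SET lambda) :
  (produced_values [set: 'I_3]%SET A #<= `I_1)%card.
Proof.
have A_ge0 (i j : 'I_3) : i != j -> 0 <= A i j.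
  by have [lambda /produces_set1_offdiag_ge0] := hA j; apply.
have [|/set0P[lambda lambdaP]] :=
  eqVneq (produced_values [set: 'I_3]%SET A) classical_sets.set0.
  by move=> ->; exact: card_ge0.
(* Trading [I_1] for the singleton of [lambda] turns the bound into an inclusion. *)
rewrite -(card_le_eqr (card_set1 (x := lambda))).
apply: subset_card_le => mu muP /=.
exact: (produces_setT_inj A_ge0 muP lambdaP).
Qed.
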